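(* Let $\lambda,\mu,\theta,\Delta>0$ and $\rho:=\lambda/\mu$. Let $A$ denote the actual amplitude of the two-dimensional update system (obtained by solving the nonlinear fixed-point equation) and let $A_1$ denote the first-order Taylor approximation of the amplitude, both as defined in the context. If $A>0$, then $$A_1\ge A .$$
   Context: The two-dimensional update system is $\dot q_i(t)=\lambda\,\frac{\exp(-\theta q_i(\Phi(t,\Delta)))}{\sum_{j=1}^2\exp(-\theta q_j(\Phi(t,\Delta)))}-\mu q_i(t)$, $i=1,2$, with $\Phi(t,\Delta)=\lfloor t/\Delta\rfloor\Delta$. Let $f(x)=\frac{1}{1+e^{-\theta(\rho-2x)}}$. The actual amplitude is $A=\frac{U-L}{2}=\frac{\rho}{2}-L$, where $L\le U$, $U=\rho-L$ are the steady-state minimum and maximum of the queue lengths and $L$ is a solution of the nonlinear fixed-point equation $\rho-L=Le^{-\mu\Delta}+\rho f(L)(1-e^{-\mu\Delta})$; the system exhibits a nonzero amplitude when $L<\rho/2$, i.e. $A>0$. The first-order Taylor approximation of the amplitude is $A_1=\frac{\rho}{2}-L_1$, where $L_1$ is the solution of $\rho-L_1=L_1e^{-\mu\Delta}+\rho\left(f(0)+f'(0)L_1\right)(1-e^{-\mu\Delta})$; explicitly, $$A_1=\frac{\rho}{2}-\frac{\rho-\rho\left(\frac{1-e^{-\mu\Delta}}{1+e^{-\rho\theta}}\right)}{1+e^{-\mu\Delta}-\frac{\rho\theta}{2}\,\mathrm{sech}^2\left(-\frac{\rho\theta}{2}\right)(1-e^{-\mu\Delta})}.$$ *)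

(* Defs.v *)
From Stdlib Require Import Reals ZArith Lra Lia.
From Coquelicot Require Import Coquelicot.
Open Scope R_scope.

Definition Phi (Delta t : R) : R := IZR (Int_part (t / Delta)) * Delta.

Definition join_prob (theta x1 x2 xi : R) : R :=
  exp (- theta * xi) / (exp (- theta * x1) + exp (- theta * x2)).

(* The right-hand side jumps at the update times k * Delta, so a solution is a
   continuous function on [0, +oo) satisfying the equation between them. *)
Definition follows_update (lam mu theta Delta : R) (q1 q2 qi : R -> R) : Prop :=
  (forall t, 0 <= t ->
     filterlim qi (within (fun s => 0 <= s) (locally t)) (locally (qi t))) /\
  (forall t, 0 < t -> (forall k : nat, t <> INR k * Delta) ->
     is_derive qi t
       (lam * join_prob theta (q1 (Phi Delta t)) (q2 (Phi Delta t))
                (qi (Phi Delta t))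
        - mu * qi t)).

Definition update_system (lam mu theta Delta : R) (q1 q2 : R -> R) : Prop :=
  follows_update lam mu theta Delta q1 q2 q1 /\
  follows_update lam mu theta Delta q1 q2 q2.

(* A steady state is a periodic regime, the constant ones included. *)
Definition steady_state (q1 q2 : R -> R) : Prop :=
  exists T, 0 < T /\
    forall t, 0 <= t -> q1 (t + T) = q1 t /\ q2 (t + T) = q2 t.

Definition has_minimum (q : R -> R) (L : R) : Prop :=
  (exists t, 0 <= t /\ q t = L) /\ (forall t, 0 <= t -> L <= q t).

Definition has_maximum (q : R -> R) (U : R) : Prop :=
  (exists t, 0 <= t /\ q t = U) /\ (forall t, 0 <= t -> q t <= U).

Definition steady_state_extrema (lam mu theta Delta L U : R) : Prop :=
  exists q1 q2 : R -> R,
    update_system lam mu theta Delta q1 q2 /\ steady_state q1 q2 /\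
    has_minimum q1 L /\ has_maximum q1 U /\
    has_minimum q2 L /\ has_maximum q2 U.

Definition f (rho theta x : R) : R := 1 / (1 + exp (- theta * (rho - 2 * x))).

Definition fixed_point_eq (rho mu theta Delta L : R) : Prop :=
  rho - L = L * exp (- mu * Delta)
            + rho * f rho theta L * (1 - exp (- mu * Delta)).

(* A relation, because the fixed-point equation need not have a unique
   solution: L = rho / 2 always is one and gives the amplitude 0. *)
Definition is_actual_amplitude (lam mu theta Delta A : R) : Prop :=
  exists L U : R,
    L <= U /\ U = lam / mu - L /\
    steady_state_extrema lam mu theta Delta L U /\
    fixed_point_eq (lam / mu) mu theta Delta L /\
    A = (U - L) / 2.

Definition taylor_fixed_point_eq (rho mu theta Delta L1 : R) : Prop :=
  rho - L1 = L1 * exp (- mu * Delta)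
             + rho * (f rho theta 0 + Derive (f rho theta) 0 * L1)
               * (1 - exp (- mu * Delta)).

Definition first_order_amplitude (lam mu theta Delta : R) : R :=
  lam / mu / 2
  - iota (fun L1 : R => taylor_fixed_point_eq (lam / mu) mu theta Delta L1).

Definition sech (x : R) : R := 1 / cosh x.

Lemma Derive_f0 (rho theta : R) :
  Derive (f rho theta) 0 = - (theta / 2) * sech (- (rho * theta / 2)) ^ 2.
Proof.
apply is_derive_unique; unfold f, sech, cosh.
assert (H : forall z, 1 + exp z <> 0) by (intro z; assert (K := exp_pos z); lra).
auto_derive; [apply H|].
replace (- - (rho * theta / 2)) with (rho * theta / 2) by ring.
replace (- theta * (rho + - (2 * 0)))
  with (- (rho * theta / 2) + - (rho * theta / 2)) by field.
rewrite exp_plus, (exp_Ropp (rho * theta / 2)).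
assert (Hp := exp_pos (rho * theta / 2)).
set (e := exp (rho * theta / 2)) in *.
field; nra.
Qed.

Lemma first_order_amplitudeE (lam mu theta Delta : R) :
  let rho := lam / mu in
  let D := 1 + exp (- mu * Delta)
           - rho * theta / 2 * sech (- (rho * theta / 2)) ^ 2
             * (1 - exp (- mu * Delta)) in
  D <> 0 ->
  first_order_amplitude lam mu theta Delta =
  rho / 2
  - (rho - rho * ((1 - exp (- mu * Delta)) / (1 + exp (- rho * theta)))) / D.
Proof.
intros rho D HD; unfold first_order_amplitude; fold rho.
set (P := fun L1 : R => taylor_fixed_point_eq rho mu theta Delta L1).
set (x := (rho - rho * ((1 - exp (- mu * Delta)) / (1 + exp (- rho * theta)))) / D).
assert (H : forall y, P y <-> y = x).
{ intro y; unfold P, taylor_fixed_point_eq; rewrite Derive_f0; unfold f.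
  replace (- theta * (rho - 2 * 0)) with (- rho * theta) by ring.
  assert (Hp := exp_pos (- rho * theta)).
  assert (Hx : x * D = rho - rho * (1 / (1 + exp (- rho * theta)))
                             * (1 - exp (- mu * Delta)))
    by (unfold x; field; lra).
  split; intro E.
  - apply (Rmult_eq_reg_r D); [|exact HD]; rewrite Hx; unfold D; lra.
  - subst y; unfold D in Hx; lra. }
assert (Px : P (iota P)).
{ apply (iota_correct P); exists x; split.
  - now apply H.
  - intros y Hy; symmetry; now apply H. }
now apply H in Px; rewrite Px.
Qed.

(* Every solution L <= rho / 2 of the fixed-point equation is realized by a
   steady state, so the dynamical conditions exclude no amplitude. *)

Definition orbit_sign (k : Z) : R := if Z.even k then 1 else -1.

Definition orbit_arc (rho mu theta Delta L : R) (k : Z) (t : R) : R :=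
  orbit_sign k * (rho * f rho theta L - rho / 2
    + (L - rho * f rho theta L) * exp (- mu * (t - IZR k * Delta))).

Definition orbit (rho mu theta Delta L t : R) : R :=
  orbit_arc rho mu theta Delta L (Int_part (t / Delta)) t.

Lemma exp_le_mono x y : x <= y -> exp x <= exp y.
Proof. intros [H| ->]; [left; now apply exp_increasing|apply Rle_refl]. Qed.

Lemma orbit_sign_succ k : orbit_sign (k + 1) = - orbit_sign k.
Proof.
unfold orbit_sign; replace (k + 1)%Z with (Z.succ k) by lia.
rewrite Z.even_succ, <- Z.negb_even; destruct (Z.even k); simpl; lra.
Qed.

Lemma orbit_sign_cases k : orbit_sign k = 1 \/ orbit_sign k = -1.
Proof. unfold orbit_sign; destruct (Z.even k); auto. Qed.

Lemma Int_part_div Delta t k : 0 < Delta ->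
  IZR k * Delta <= t < (IZR k + 1) * Delta -> Int_part (t / Delta) = k.
Proof.
intros HD [H1 H2]; symmetry; apply Int_part_spec.
assert (E : t = t / Delta * Delta) by (field; lra).
split; [|nra].
apply (Rmult_lt_reg_r Delta); nra.
Qed.

Lemma Int_part_div_bounds Delta t : 0 < Delta ->
  let k := Int_part (t / Delta) in
  IZR k * Delta <= t < (IZR k + 1) * Delta.
Proof.
intros HD k; destruct (base_Int_part (t / Delta)) as [H1 H2]; fold k in H1, H2.
assert (E : t = t / Delta * Delta) by (field; lra).
split; nra.
Qed.

Section Orbit.
Variables rho mu theta Delta L : R.
Hypotheses (hrho : 0 < rho) (hmu : 0 < mu) (htheta : 0 < theta)
  (hDelta : 0 < Delta) (hL : fixed_point_eq rho mu theta Delta L)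
  (hLU : L <= rho - L).

Local Notation arc := (orbit_arc rho mu theta Delta L).
Local Notation y := (orbit rho mu theta Delta L).

Lemma arc_start k : arc k (IZR k * Delta) = orbit_sign k * (L - rho / 2).
Proof. unfold orbit_arc; rewrite Rminus_diag, Rmult_0_r, exp_0; ring. Qed.

Lemma arc_join k :
  arc k (IZR (k + 1) * Delta) = arc (k + 1) (IZR (k + 1) * Delta).
Proof.
rewrite arc_start, orbit_sign_succ; unfold orbit_arc; rewrite plus_IZR.
replace (- mu * ((IZR k + 1) * Delta - IZR k * Delta))
  with (- mu * Delta) by ring.
unfold fixed_point_eq in hL; revert hL.
set (e := exp _); set (g := f _ _ _); intro E.
replace (rho * g - rho / 2 + (L - rho * g) * e)
  with (L * e + rho * g * (1 - e) - rho / 2) by ring.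
rewrite <- E; field.
Qed.

Lemma arc_continuous k t : continuous (arc k) t.
Proof. apply (ex_derive_continuous (arc k)); unfold orbit_arc; auto_derive; auto. Qed.

Lemma orbit_near t : exists k k', arc k t = y t /\ arc k' t = y t /\
  locally t (fun s => y s = arc k s \/ y s = arc k' s).
Proof.
set (k := Int_part (t / Delta)).
destruct (Int_part_div_bounds Delta t hDelta) as [H1 H2]; fold k in H1, H2.
destruct (Req_dec t (IZR k * Delta)) as [E|E].
- exists k, (k - 1)%Z; split; [reflexivity|split].
  + assert (J := arc_join (k - 1)); replace (k - 1 + 1)%Z with k in J by lia.
    unfold orbit; fold k; rewrite E; exact J.
  + exists (mkposreal _ hDelta); intros s Hs.
    change (Rabs (s - t) < Delta) in Hs; apply Rabs_lt_between in Hs.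
    destruct (Rle_dec t s).
    * left; unfold orbit; rewrite (Int_part_div _ _ k); auto; lra.
    * right; unfold orbit; rewrite (Int_part_div _ _ (k - 1)); auto.
      rewrite minus_IZR; lra.
- exists k, k; split; [reflexivity|split; [reflexivity|]].
  assert (Hm : 0 < Rmin (t - IZR k * Delta) ((IZR k + 1) * Delta - t))
    by (apply Rmin_glb_lt; lra).
  exists (mkposreal _ Hm); intros s Hs.
  change (Rabs (s - t) < Rmin (t - IZR k * Delta) ((IZR k + 1) * Delta - t)) in Hs.
  assert (A1 := Rmin_l (t - IZR k * Delta) ((IZR k + 1) * Delta - t)).
  assert (A2 := Rmin_r (t - IZR k * Delta) ((IZR k + 1) * Delta - t)).
  apply Rabs_lt_between in Hs.
  left; unfold orbit; rewrite (Int_part_div _ _ k); auto; lra.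
Qed.

Lemma orbit_continuous t : continuous y t.
Proof.
destruct (orbit_near t) as (k & k' & E & E' & H).
intros P HP.
assert (C := arc_continuous k t P); rewrite E in C; specialize (C HP).
assert (C' := arc_continuous k' t P); rewrite E' in C'; specialize (C' HP).
unfold filtermap in *.
assert (CC := filter_and _ _ H (filter_and _ _ C C')).
revert CC; apply filter_imp; intros s [[->| ->] [? ?]]; assumption.
Qed.

Lemma orbit_update k : y (IZR k * Delta) = orbit_sign k * (L - rho / 2).
Proof. unfold orbit; rewrite (Int_part_div _ _ k); auto; [apply arc_start|lra]. Qed.

Lemma join_prob_orbit (s : R) (c : R) : (s = 1 \/ s = -1) -> (c = 1 \/ c = -1) ->
  let x a := rho / 2 + a * (s * (L - rho / 2)) in
  rho * join_prob theta (x 1) (x (-1)) (x c)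
  = rho / 2 + c * s * (rho * f rho theta L - rho / 2).
Proof.
intros Hs Hc x; unfold join_prob, f, x.
set (a := exp (- theta * L)); set (b := exp (- theta * (rho - L))).
assert (Ha : 0 < a) by apply exp_pos.
assert (Hb : 0 < b) by apply exp_pos.
assert (Hab : exp (- theta * (rho - 2 * L)) = b / a).
{ unfold Rdiv, a; rewrite <- exp_Ropp; unfold b; rewrite <- exp_plus.
  f_equal; ring. }
rewrite Hab.
assert (X : forall c', c' = 1 \/ c' = -1 ->
  exp (- theta * (rho / 2 + c' * (s * (L - rho / 2))))
  = (1 + c' * s) / 2 * a + (1 - c' * s) / 2 * b).
{ intros c' Hc'; destruct Hs as [->| ->], Hc' as [->| ->];
    match goal with
    | |- exp ?z = ?u * a + ?v * b =>
        (replace z with (- theta * L) by field; fold a; field) ||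
        (replace z with (- theta * (rho - L)) by field; fold b; field)
    end. }
rewrite !X by auto.
destruct Hs as [->| ->], Hc as [->| ->]; field; lra.
Qed.

Lemma orbit_derive t : (forall k : Z, t <> IZR k * Delta) ->
  is_derive y t
    (mu * (orbit_sign (Int_part (t / Delta)) * (rho * f rho theta L - rho / 2))
     - mu * y t).
Proof.
intro Ht; set (k := Int_part (t / Delta)).
destruct (Int_part_div_bounds Delta t hDelta) as [H1 H2]; fold k in H1, H2.
assert (Hk := Ht k).
apply is_derive_ext_loc with (arc k).
- assert (Hm : 0 < Rmin (t - IZR k * Delta) ((IZR k + 1) * Delta - t))
    by (apply Rmin_glb_lt; lra).
  exists (mkposreal _ Hm); intros s Hs.
  change (Rabs (s - t) < Rmin (t - IZR k * Delta) ((IZR k + 1) * Delta - t)) in Hs.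
  assert (A1 := Rmin_l (t - IZR k * Delta) ((IZR k + 1) * Delta - t)).
  assert (A2 := Rmin_r (t - IZR k * Delta) ((IZR k + 1) * Delta - t)).
  apply Rabs_lt_between in Hs.
  unfold orbit; rewrite (Int_part_div _ _ k); auto; lra.
- unfold orbit; fold k; unfold orbit_arc; auto_derive; auto.
  unfold Rminus; ring.
Qed.

Lemma orbit_bound t : L - rho / 2 <= y t <= rho / 2 - L.
Proof.
set (k := Int_part (t / Delta)).
destruct (Int_part_div_bounds Delta t hDelta) as [H1 H2]; fold k in H1, H2.
unfold orbit; fold k; unfold orbit_arc.
set (e := exp (- mu * (t - IZR k * Delta))).
assert (He : exp (- mu * Delta) <= e <= 1).
{ unfold e; split.
  - apply exp_le_mono; nra.
  - rewrite <- exp_0; apply exp_le_mono; nra. }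
assert (HE : exp (- mu * Delta) < 1)
  by (rewrite <- exp_0; apply exp_increasing; nra).
unfold fixed_point_eq in hL; revert hL HE He.
set (E := exp (- mu * Delta)); set (g := f rho theta L); intros F HE He.
assert (B : L - rho * g <= 0) by nra.
assert (B1 : (L - rho * g) * e <= (L - rho * g) * E) by nra.
assert (B2 : (L - rho * g) * 1 <= (L - rho * g) * e) by nra.
destruct (orbit_sign_cases k) as [-> | ->]; lra.
Qed.

Lemma orbit_periodic t : y (t + 2 * Delta) = y t.
Proof.
set (k := Int_part (t / Delta)).
destruct (Int_part_div_bounds Delta t hDelta) as [H1 H2]; fold k in H1, H2.
unfold orbit; fold k; rewrite (Int_part_div _ _ (k + 1 + 1)); auto.
- unfold orbit_arc; rewrite !orbit_sign_succ, !plus_IZR, Ropp_involutive.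
  do 4 f_equal; ring.
- rewrite !plus_IZR; lra.
Qed.

Lemma steady_state_extrema_orbit :
  steady_state_extrema (rho * mu) mu theta Delta L (rho - L).
Proof.
assert (S : forall c, (c = 1 \/ c = -1) ->
  follows_update (rho * mu) mu theta Delta
    (fun t => rho / 2 + 1 * y t) (fun t => rho / 2 + (-1) * y t)
    (fun t => rho / 2 + c * y t)).
{ intros c Hc; split.
  - intros t _; apply (filterlim_filter_le_1 (F := locally t)).
    + apply filter_le_within.
    + apply (continuous_plus (fun _ => rho / 2) (fun t => c * y t)).
      * apply continuous_const.
      * apply (continuous_scal_r c y), orbit_continuous.
  - intros t Ht Hk; set (k := Int_part (t / Delta)).
    unfold Phi; fold k; rewrite !orbit_update.
    assert (J := join_prob_orbit (orbit_sign k) c (orbit_sign_cases k) Hc).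
    cbv zeta in J.
    assert (Hz : forall j : Z, t <> IZR j * Delta).
    { intros j E; destruct (Z_lt_le_dec j 0) as [Hj|Hj].
      - apply IZR_lt in Hj; nra.
      - apply (Hk (Z.to_nat j)); rewrite INR_IZR_INZ, Z2Nat.id; auto. }
    assert (Hd := orbit_derive t Hz); fold k in Hd.
    rewrite (Rmult_comm rho mu), Rmult_assoc, J.
    replace (mu * _ - mu * _) with
      (plus 0 (c * (mu * (orbit_sign k * (rho * f rho theta L - rho / 2))
              - mu * y t))) by (unfold plus; simpl; ring).
    apply @is_derive_plus; [apply @is_derive_const|].
    apply @is_derive_scal; exact Hd. }
assert (Y0 := orbit_update 0); assert (Y1 := orbit_update 1).
unfold orbit_sign in Y0, Y1; simpl in Y0, Y1.
exists (fun t => rho / 2 + 1 * y t), (fun t => rho / 2 + (-1) * y t).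
split; [split; apply S; auto|split].
- exists (2 * Delta); split; [lra|intros t _; now rewrite orbit_periodic].
- repeat split; try (intros t _; assert (B := orbit_bound t); lra);
    first [ exists (0 * Delta); split; [lra|rewrite Y0; lra]
          | exists (1 * Delta); split; [lra|rewrite Y1; lra] ].
Qed.

End Orbit.

Lemma is_actual_amplitudeE (lam mu theta Delta A : R) :
  0 < lam -> 0 < mu -> 0 < theta -> 0 < Delta ->
  is_actual_amplitude lam mu theta Delta A <->
  exists L, L <= lam / mu - L /\ fixed_point_eq (lam / mu) mu theta Delta L /\
            A = lam / mu / 2 - L.
Proof.
intros Hl Hm Ht HD; split.
- intros (L & U & H & -> & _ & HF & ->); exists L; repeat split; auto; lra.
- intros (L & H & HF & ->); exists L, (lam / mu - L); repeat split; auto; try lra.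
  replace lam with (lam / mu * mu) at 1 by (field; lra).
  apply steady_state_extrema_orbit; auto.
Qed.

(* Main.v *)
Require Import Defs.
From Stdlib Require Import Reals Lra.
From Coquelicot Require Import Coquelicot.
(* [f] is the logistic function, not the projection of the record [family] of
   the real-analysis library. *)
Import Defs.
Open Scope R_scope.

(** The logistic function is concave where its argument is nonnegative, so on
    [0, rho / 2] the graph of [f] lies below its tangent at 0
    ([f_below_tangent]).  The actual minimum [L] solves
    [L (1 + e) + rho f(L) (1 - e) = rho] with [e = exp (- mu Delta)], and [L1]
    solves the same equation with [f] replaced by its tangent, that is
    [L1 D = N] with [D = 1 + e + rho f'(0) (1 - e)] and
    [N = rho - rho f(0) (1 - e)].  A positive amplitude means [L < rho / 2], and
    [f < 1] makes [L] and [N] positive.  So [L] lies where the tangent bound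
    holds, and replacing [f(L)] by the larger tangent value gives
    [L D >= N].  This forces [D > 0], hence [L >= N / D = L1], and the
    amplitudes are [rho / 2] minus these minima. *)

Lemma f_is_derive (rho theta x : R) :
  let E := exp (- theta * (rho - 2 * x)) in
  is_derive (f rho theta) x (- (2 * theta) * (E / (1 + E) ^ 2)).
Proof.
intros E; unfold f.
assert (HE : 0 < E) by apply exp_pos.
auto_derive.
- replace (- theta * (rho + - (2 * x))) with (- theta * (rho - 2 * x)) by ring.
  fold E; lra.
- replace (- theta * (rho + - (2 * x))) with (- theta * (rho - 2 * x)) by ring.
  fold E; field; lra.
Qed.

Lemma f_lt_1 (rho theta x : R) : f rho theta x < 1.
Proof.
unfold f; assert (HE := exp_pos (- theta * (rho - 2 * x))).
apply Rlt_div_l; lra.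
Qed.

(** In terms of [E = exp (- z)], this is the monotonicity of the slope
    [E / (1 + E) ^ 2] of the logistic function at [z]: the difference of the
    two sides has the sign of [(b - a) (1 - a b)]. *)
Lemma logistic_slope_le (a b : R) :
  0 < a -> a <= b -> b <= 1 -> a / (1 + a) ^ 2 <= b / (1 + b) ^ 2.
Proof.
intros Ha Hab Hb.
apply Rminus_le_0.
replace (b / (1 + b) ^ 2 - a / (1 + a) ^ 2)
  with ((b - a) * (1 - a * b) / ((1 + a) ^ 2 * (1 + b) ^ 2)) by (field; lra).
apply Rdiv_le_0_compat; [apply Rmult_le_pos; nra|].
apply Rmult_lt_0_compat; apply pow_lt; lra.
Qed.

(** By the mean value theorem the chord from 0 to [x] has the slope of [f] at
    some intermediate point, and that slope is at most [f'(0)] because [f] is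
    concave up to its inflection point [rho / 2]. *)
Lemma f_below_tangent (rho theta x : R) :
  0 < theta -> 0 <= x <= rho / 2 ->
  f rho theta x <= f rho theta 0 + Derive (f rho theta) 0 * x.
Proof.
intros Ht [Hx0 Hx].
rewrite (is_derive_unique _ _ _ (f_is_derive rho theta 0)).
destruct (MVT_gen (f rho theta) 0 x _ (fun t _ => f_is_derive rho theta t))
  as (c & Hc & Heq).
- intros t _; apply derivable_continuous_pt, ex_derive_Reals_0.
  eexists; apply f_is_derive.
- rewrite Rmin_left, Rmax_right in Hc by lra.
  assert (S := logistic_slope_le (exp (- theta * (rho - 2 * 0)))
                                 (exp (- theta * (rho - 2 * c)))).
  specialize (S (exp_pos _)).
  assert (H1 : exp (- theta * (rho - 2 * 0)) <= exp (- theta * (rho - 2 * c)))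
    by (apply exp_le_mono; nra).
  assert (H2 : exp (- theta * (rho - 2 * c)) <= 1)
    by (rewrite <- exp_0; apply exp_le_mono; nra).
  specialize (S H1 H2).
  cbv zeta in Heq |- *.
  set (S0 := _ / _) in S |- *.
  set (Sc := _ / (1 + exp (- theta * (rho - 2 * c))) ^ 2) in S, Heq.
  assert (0 <= 2 * theta * x * (Sc - S0)) by (apply Rmult_le_pos; nra).
  lra.
Qed.

Theorem theorem2p5 (lam mu theta Delta : R)
  (hlam : 0 < lam) (hmu : 0 < mu) (htheta : 0 < theta) (hDelta : 0 < Delta)
  (A : R) (hA : is_actual_amplitude lam mu theta Delta A) (hApos : A > 0) :
  first_order_amplitude lam mu theta Delta >= A.
Proof.
destruct hA as (L & U & _ & -> & _ & HL & ->).
assert (Hrho : 0 < lam / mu) by (apply Rdiv_lt_0_compat; assumption).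
assert (HE := first_order_amplitudeE lam mu theta Delta).
cbv zeta in HE.
set (rho := lam / mu) in *; clearbody rho.
unfold fixed_point_eq in HL.
assert (He0 : 0 < exp (- mu * Delta)) by apply exp_pos.
assert (He1 : exp (- mu * Delta) < 1)
  by (rewrite <- exp_0; apply exp_increasing; nra).
set (e := exp (- mu * Delta)) in *.
assert (f0E : f rho theta 0 = 1 / (1 + exp (- rho * theta))).
{ unfold f; do 3 f_equal; ring. }
set (x0 := exp (- rho * theta)) in *.
assert (Hx0 : 0 < x0) by apply exp_pos.
assert (Hf : forall y, rho * f rho theta y * (1 - e) < rho).
{ intro y; assert (B := f_lt_1 rho theta y).
  assert (0 < rho * (1 - f rho theta y) * (1 - e))
    by (repeat apply Rmult_lt_0_compat; lra).
  assert (0 < rho * e) by (apply Rmult_lt_0_compat; lra).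
  lra. }
assert (HLpos : 0 < L).
{ assert (HfL := Hf L).
  apply (Rmult_lt_reg_r (1 + e)); lra. }
assert (HT : f rho theta L <= f rho theta 0 + Derive (f rho theta) 0 * L)
  by (apply f_below_tangent; lra).
rewrite Derive_f0 in HT.
replace (rho - rho * ((1 - e) / (1 + x0)))
  with (rho - rho * f rho theta 0 * (1 - e)) in HE
  by (rewrite f0E; field; lra).
set (s := sech (- (rho * theta / 2)) ^ 2) in *.
set (D := 1 + e - rho * theta / 2 * s * (1 - e)) in *.
set (N := rho - rho * f rho theta 0 * (1 - e)) in *.
assert (HN : 0 < N) by (assert (Hf0 := Hf 0); unfold N; lra).
(* The tangent bound at [L], multiplied by [rho (1 - e)] and added to the
   fixed-point equation. *)
assert (HLD : N <= L * D).
{ assert (0 <= rho * (1 - e) *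
            (f rho theta 0 + - (theta / 2) * s * L - f rho theta L))
    by (apply Rmult_le_pos; [nra|lra]).
  unfold N, D; nra. }
assert (HD : 0 < D) by nra.
rewrite HE by lra.
assert (N / D <= L) by (apply Rle_div_l; lra).
lra.
Qed.
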